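(* Let $\{b_1(i,j), b_2(i,j)\}_{i,j\in\mathbb{Z}_{\ge 1}}$ be parameters in $[0,1]$, and assume there exist $I,J\in\mathbb{Z}_{\ge 1}$ such that $b_k(i+I,j)=b_k(i,j)$ and $b_k(i,j+J)=b_k(i,j)$ for all $i,j\in\mathbb{Z}_{\ge1}$ and $k\in\{1,2\}$. Let $H$ be the height function of the complemented stochastic six vertex (CS6V) model on the first quadrant with these parameters and empty boundary data. Then there exists a (deterministic) Lipschitz function $g:\mathbb{R}_{\ge 0}^2\to\mathbb{R}$ such that with probability $1$, $$\lim_{n\to\infty}\frac{H(\lfloor nx\rfloor,\lfloor ny\rfloor)}{n}=y-g(x,y)\qquad\text{for all } x,y\in\mathbb{R}_{\ge 0}.$$
   Context: Complemented stochastic six vertex (CS6V) model with empty boundary data. The vertex set is $\mathbb{Z}_{\ge1}^2$. Each vertex $(i,j)$ has two input edges (bottom and left) and two output edges (top and right); the top edge of $(i,j)$ is the bottom edge of $(i,j+1)$ and the right edge of $(i,j)$ is the left edge of $(i+1,j)$. Each edge carries $0$ or $1$ line. Empty boundary data: no line enters the quadrant from the left boundary (left edges of $(1,j)$) or from the bottom boundary (bottom edges of $(i,1)$). The vertices are processed sequentially in the order $(1,1),(2,1),(1,2),(3,1),(2,2),(1,3),\dots$. At vertex $(i,j)$, given its inputs, the outputs are sampled (conditionally independently of everything else sampled before) as follows: - only the bottom input occupied: only the top output is occupied, with probability $1$; - only the left input occupied: only the right output is occupied, with probability $1$; - both inputs occupied: both outputs are occupied with probability $b_1(i,j)$, no output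 is occupied with probability $1-b_1(i,j)$; - no input occupied: no output is occupied with probability $b_2(i,j)$, both outputs are occupied with probability $1-b_2(i,j)$. The height function $H$ on $\mathbb{Z}_{\ge0}^2$ records the number of lines to the left of $(x,y)$: explicitly, for $y\ge1$, $H(x,y)$ is the number of $z\in\{1,\dots,x\}$ such that the top output edge of $(z,y)$ is occupied, and $H(x,0)=0$. *)

(* Defs.v *)
From HB Require Import structures.
From mathcomp Require Import all_boot all_order all_algebra.
From mathcomp Require Import all_classical all_reals all_analysis.

Set Implicit Arguments.
Unset Strict Implicit.
Unset Printing Implicit Defensive.

Import Order.TTheory GRing.Theory Num.Theory.
Import numFieldNormedType.Exports.

Local Open Scope classical_set_scope.
Local Open Scope ring_scope.

(* [c i j] is the pair (top output, right output) of the vertex [(i, j)], where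
   [true] means that the edge carries a line. Only the values at [1 <= i] and
   [1 <= j] are meaningful. *)
Definition config := nat -> nat -> bool * bool.

(* The [false] on the boundary is the empty boundary data. *)
Definition bottom_input (c : config) (i j : nat) : bool :=
  if (j <= 1)%N then false else (c i j.-1).1.

Definition left_input (c : config) (i j : nat) : bool :=
  if (i <= 1)%N then false else (c i.-1 j).2.

Definition vertex_weight (R : realType) (b1 b2 : R) (bottom left : bool)
    (out : bool * bool) : R :=
  match bottom, left with
  | true, false => (out == (true, false))%:R
  | false, true => (out == (false, true))%:R
  | true, true =>
      if out == (true, true) then b1
      else if out == (false, false) then 1 - b1 else 0
  | false, false =>
      if out == (false, false) then b2
      else if out == (true, true) then 1 - b2 else 0
  end.

(* The order (1,1), (2,1), (1,2), (3,1), (2,2), (1,3), ... *)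
Definition sampled_before (i' j' i j : nat) : bool :=
  (i' + j' < i + j)%N || ((i' + j' == i + j)%N && (j' < j)%N).

Definition past_event (T : Type) (X : T -> config) (i j : nat) (c : config) :
    set T :=
  [set w | forall i' j' : nat, (1 <= i')%N -> (1 <= j')%N ->
     sampled_before i' j' i j -> X w i' j' = c i' j'].

(* The sampling rule says that, conditionally on the outputs of all the vertices
   sampled before [(i, j)], the output of [(i, j)] has law [vertex_weight]. It is
   written in product form so that pasts of probability 0 need no convention. *)
Record is_CS6V (R : realType) (b1 b2 : nat -> nat -> R) (d : measure_display)
    (T : measurableType d) (P : probability T R) (X : T -> config) : Prop := {
  CS6V_measurable : forall i j : nat, (1 <= i)%N -> (1 <= j)%N ->
    measurable_fun [set: T] (fun w => X w i j);
  CS6V_sampling : forall i j : nat, (1 <= i)%N -> (1 <= j)%N ->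
    forall (c : config) (out : bool * bool),
    P (past_event X i j c `&` [set w | X w i j = out]) =
    (P (past_event X i j c) *
     (vertex_weight (b1 i j) (b2 i j)
        (bottom_input c i j) (left_input c i j) out)%:E)%E
}.

Definition height (c : config) (x y : nat) : nat :=
  if y == 0%N then 0%N else (\sum_(1 <= z < x.+1) (c z y).1)%N.

Definition quadrant (R : realType) : set (R * R) :=
  [set z | 0 <= z.1 /\ 0 <= z.2].
Arguments quadrant R : clear implicits.

(* Main.v *)
Require Import Defs.
From HB Require Import structures.
From mathcomp Require Import all_boot all_order all_algebra.
From mathcomp Require Import all_classical all_reals all_analysis.
From mathcomp Require Import zify ring lra.
Set Implicit Arguments.
Unset Strict Implicit.
Unset Printing Implicit Defensive.

Import Order.TTheory GRing.Theory Num.Theory.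
Import numFieldNormedType.Exports.

Local Open Scope classical_set_scope.
Local Open Scope ring_scope.

(** Exchanging occupied and empty horizontal edges turns the complemented model
    with empty boundary into the stochastic six vertex model in which lines are
    conserved, every left boundary edge is occupied and no line comes from below.
    In this picture y - H(x, y) is the number N(x, y) of lines that cross column x
    in rows 1..y, and g is the limit of the mean of N(n x, n y) / n.

    The dynamics is driven by two independent bits per site. Run from ordered
    boundary data in the same environment, two configurations remain ordered. With
    conservation this gives [crossings_subadditive]: N at (x + x', y + y') is at
    most N at (x, y) plus the number N' of crossings at (x', y') in the environment
    shifted by (x, y). If (x, y) is a multiple of the periods, N' has the law of N
    and is independent of N(x, y), as it reads other sites.

    Means: subadditivity and Fekete's lemma give the limit g ([mean_cvg]). It is
    Lipschitz because N changes by at most one when x or y does.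

    Fluctuations: independence replaces the subadditive ergodic theorem. Squaring
    N(2x, 2y) <= N(x, y) + N'(x, y) and taking expectations, the second moment of
    N(2x, 2y) is at most four times the one of N(x, y) minus twice the variance of
    N(x, y). Hence the variances of N(2^k x, 2^k y) / 2^k have a telescoping bound
    and are summable ([variance_dyadic]), so that Chebyshev and Borel-Cantelli
    control N - E N along doublings of every lattice point
    ([dyadic_deviation]). Countably many lattice points are enough: by the Lipschitz
    property they control N - E N at all scales and in all directions at once
    ([dyadic_interpolation]).

    Everything above concerns finitely many sites at a time, so the expectation is an
    iterated average over sites ([expect]), and the given process is compared with
    it only through events decided in a finite box ([local_event_law]). *)

(** * Line configurations in a fixed environment *)

(** The randomness of the model: two independent bits at every site, the first
    used when a line comes only from below, the second when one comes only from
    the left. All initial conditions are run in the same environment. *)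
Definition env := nat * nat -> bool * bool.

Definition shift_env (x y : nat) (w : env) : env :=
  fun v => w (x + v.1, y + v.2)%N.

(** Stochastic six vertex rule, obtained from the complemented rule by exchanging
    occupied and empty horizontal edges: lines are now conserved. When a single
    line enters, the relevant bit decides whether it goes straight or turns. *)
Definition vertex_map (u : bool * bool) (bottom left : bool) : bool * bool :=
  if bottom == left then (bottom, left)
  else if bottom then (u.1, ~~ u.1) else (~~ u.2, u.2).

(** Only vertices with positive coordinates obey the rule. The first component at
    row 0 and the second one at column 0 are the boundary data, so that the
    translate of a configuration is again a configuration. *)
Definition flow_in (w : env) (G : config) : Prop :=
  forall i j : nat,
    G i.+1 j.+1 = vertex_map (w (i.+1, j.+1)) (G i.+1 j).1 (G i j.+1).2.

Definition shift_flow (x y : nat) (G : config) : config :=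
  fun i j => G (x + i)%N (y + j)%N.

Lemma shift_flow_in (x y : nat) (w : env) (G : config) :
  flow_in w G -> flow_in (shift_env x y w) (shift_flow x y G).
Proof. by move=> wG i j; rewrite /shift_flow /shift_env /= !addnS wG. Qed.

Fixpoint flow_rows (w : env) (B L : nat -> bool) (j : nat) : nat -> bool * bool :=
  match j with
  | 0%N => fun i => (B i, false)
  | j'.+1 => fix row (i : nat) : bool * bool :=
      match i with
      | 0%N => (false, L j'.+1)
      | i'.+1 => vertex_map (w (i'.+1, j'.+1))
                            (flow_rows w B L j' i'.+1).1 (row i').2
      end
  end.

Definition flow (w : env) (B L : nat -> bool) : config :=
  fun i j => flow_rows w B L j i.

Lemma flowP (w : env) (B L : nat -> bool) : flow_in w (flow w B L).
Proof. by []. Qed.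

Definition step_flow (w : env) : config := flow w xpred0 xpredT.

(** Turning decisions are made per edge type, not per line: if the smaller input
    has exactly one line then either the larger input is the same, or it has two
    lines and fills both outputs. *)
Lemma vertex_map_mono (u : bool * bool) (b l b' l' : bool) :
  (b <= b')%N -> (l <= l')%N ->
  ((vertex_map u b l).1 <= (vertex_map u b' l').1)%N
  /\ ((vertex_map u b l).2 <= (vertex_map u b' l').2)%N.
Proof. by case: u => -[] [] /=; case: b; case: b'; case: l; case: l'. Qed.

Lemma flow_mono (w : env) (G G' : config) :
  flow_in w G -> flow_in w G' ->
  (forall i, (G i.+1 0%N).1 <= (G' i.+1 0%N).1)%N ->
  (forall j, (G 0%N j.+1).2 <= (G' 0%N j.+1).2)%N ->
  forall i j, ((G i.+1 j).1 <= (G' i.+1 j).1)%N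
           /\ ((G i j.+1).2 <= (G' i j.+1).2)%N.
Proof.
move=> wG wG' leB leL.
suff H n i j : (i + j < n)%N -> ((G i.+1 j).1 <= (G' i.+1 j).1)%N
           /\ ((G i j.+1).2 <= (G' i j.+1).2)%N by move=> i j; exact: H (ltnSn _).
elim: n i j => // n IHn i j ijn; split.
- case: j ijn => [|j] ijn; first exact: leB.
  have [h1 h2] := IHn i j ltac:(lia).
  by rewrite wG wG'; case: (vertex_map_mono (w (i.+1, j.+1)) h1 h2).
- case: i ijn => [|i] ijn; first exact: leL.
  have [h1 h2] := IHn i j ltac:(lia).
  by rewrite wG wG'; case: (vertex_map_mono (w (i.+1, j.+1)) h1 h2).
Qed.

(** Lines only travel up and right, so the outputs at a vertex depend on the sites
    to its lower left only. *)
Lemma flow_local (w w' : env) (B L : nat -> bool) (x y : nat) :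
  (forall i j, (i <= x)%N -> (j <= y)%N -> w (i.+1, j.+1) = w' (i.+1, j.+1)) ->
  flow w B L x.+1 y.+1 = flow w' B L x.+1 y.+1.
Proof.
move=> ww'.
suff H n i j : (i + j < n)%N -> (i <= x)%N -> (j <= y)%N ->
    flow w B L i.+1 j.+1 = flow w' B L i.+1 j.+1 by exact: (H _ _ _ (ltnSn _)).
elim: n i j => // n IHn i j ijn ix jy.
rewrite 2!flowP ww' //; congr vertex_map.
- by case: j ijn jy => // j ijn jy; rewrite IHn //; lia.
- by case: i ijn ix => // i ijn ix; rewrite IHn //; lia.
Qed.

Definition tops (G : config) (x y : nat) : nat := (\sum_(i < x) (G i.+1 y).1)%N.

Definition rights (G : config) (x y : nat) : nat := (\sum_(j < y) (G x j.+1).2)%N.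

Lemma vertex_map_conservation (u : bool * bool) (b l : bool) :
  (l + b = (vertex_map u b l).2 + (vertex_map u b l).1)%N.
Proof. by case: u => -[] [] /=; case: b; case: l. Qed.

Lemma column_conservation (w : env) (G : config) (x y : nat) : flow_in w G ->
  (rights G x y + (G x.+1 0).1 = rights G x.+1 y + (G x.+1 y).1)%N.
Proof.
move=> wG; elim: y => [|y IHy]; first by rewrite /rights !big_ord0.
have := vertex_map_conservation (w (x.+1, y.+1)) (G x.+1 y).1 (G x y.+1).2.
by move: IHy; rewrite /rights !big_ord_recr /= -wG; lia.
Qed.

Lemma conservation (w : env) (G : config) (x y : nat) : flow_in w G ->
  (rights G 0 y + tops G x 0 = rights G x y + tops G x y)%N.
Proof.
move=> wG; elim: x => [|x IHx]; first by rewrite /tops !big_ord0.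
have := column_conservation x y wG.
by move: IHx; rewrite /tops !big_ord_recr /=; lia.
Qed.

(** The quantity y - H of the complemented model, see [height_cs6v]: it is
    subadditive, whereas H counts the lines that went up. *)
Definition crossings (w : env) (x y : nat) : nat := rights (step_flow w) x y.

Lemma crossings0 (w : env) (y : nat) : crossings w 0 y = y.
Proof.
by rewrite /crossings /rights (eq_bigr (fun=> 1%N)) ?sum1_card ?card_ord.
Qed.

Lemma step_flow_tops0 (w : env) (x : nat) : tops (step_flow w) x 0 = 0%N.
Proof. by rewrite /tops big1. Qed.

Lemma rightsD (G : config) (x x' y y' : nat) :
  (rights G (x + x') (y + y') =
   rights G (x + x') y + rights (shift_flow x y G) x' y')%N.
Proof.
rewrite /rights big_split_ord /=; congr (_ + _)%N.
by apply: eq_bigr => j _; rewrite /shift_flow addnS.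
Qed.

(** Restart the dynamics from the corner (x, y) with every left edge occupied and
    no line from below. Compared with the true configuration, lines are added on
    the left, which can only increase the flux, and lines are removed from below;
    by conservation a line entering from below adds at most one to the flux, and
    that line was lost by the flux through rows 1..y when it left them. *)
Lemma crossings_subadditive (w : env) (x x' y y' : nat) :
  (crossings w (x + x') (y + y') <=
   crossings w x y + crossings (shift_env x y w) x' y')%N.
Proof.
rewrite /crossings; set G := step_flow w; set w' := shift_env x y w.
have wG : flow_in w G := @flowP w _ _.
rewrite rightsD; set E := shift_flow x y G.
have w'E : flow_in w' E := shift_flow_in x y wG.
(* Z keeps the lines of E that enter the shifted quadrant from the left and
   forgets those that enter from below: it lies under E and under the step
   configuration at the same time. *)
pose Z := flow w' xpred0 (fun j => (E 0%N j).2).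
have w'Z : flow_in w' Z := @flowP _ _ _.
have ZE i j : ((Z i.+1 j).1 <= (E i.+1 j).1)%N /\ ((Z i j.+1).2 <= (E i j.+1).2)%N.
  exact: flow_mono w'Z w'E _ _ i j.
have ZS i j : ((Z i.+1 j).1 <= (step_flow w' i.+1 j).1)%N
    /\ ((Z i j.+1).2 <= (step_flow w' i j.+1).2)%N.
  by apply: (flow_mono w'Z (@flowP w' _ _) _ _ i j) => // k; exact: leq_b1.
(* Nothing enters below row 1, so what is lost between columns x and x + x' in
   rows 1..y leaves through row y, that is, enters E from below. *)
have strip : (rights G x y = rights G (x + x') y + tops E x' 0)%N.
  have := conservation x' y (shift_flow_in x 0 wG).
  have -> : tops (shift_flow x 0 G) x' 0 = 0%N.
    by apply: big1 => i _; rewrite /shift_flow addnS.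
  have -> : tops (shift_flow x 0 G) x' y = tops E x' 0.
    by apply: eq_bigr => i _; rewrite /E /shift_flow add0n addn0.
  by rewrite /rights /shift_flow /= !addn0.
have consE := conservation x' y' w'E.
have consZ := conservation x' y' w'Z.
have tZ0 : tops Z x' 0 = 0%N by apply: big1.
have L0 : rights Z 0 y' = rights E 0 y' by apply: eq_bigr.
have tZE : (tops Z x' y' <= tops E x' y')%N 
  by apply: leq_sum => i _; case: (ZE i y').
have rZS : (rights Z x' y' <= rights (step_flow w') x' y')%N.
  by apply: leq_sum => j _; case: (ZS x' j).
lia.
Qed.

Lemma crossingsS (w : env) (x y : nat) :
  (crossings w x y <= crossings w x y.+1 <= (crossings w x y).+1)%N.
Proof.
by rewrite /crossings /rights big_ord_recr /=; case: (step_flow w x y.+1).2; lia.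
Qed.

(** Conservation in a single column. *)
Lemma crossingsSx (w : env) (x y : nat) :
  (crossings w x.+1 y <= crossings w x y <= (crossings w x.+1 y).+1)%N.
Proof.
have := column_conservation x y (@flowP w xpred0 xpredT).
by rewrite -/(step_flow w) /crossings /=; case: (step_flow w x.+1 y).1; lia.
Qed.

Lemma crossings_local (w w' : env) (x y : nat) :
  (forall i j, (i < x)%N -> (j < y)%N -> w (i.+1, j.+1) = w' (i.+1, j.+1)) ->
  crossings w x y = crossings w' x y.
Proof.
case: x => [|x] ww'; first by rewrite !crossings0.
apply: eq_bigr => -[j /= jy] _; rewrite /step_flow.
by rewrite (@flow_local w w') // => i k ix kj; apply: ww' => //; lia.
Qed.

Definition cs6v (w : env) : config :=
  fun i j => ((step_flow w i j).1, ~~ (step_flow w i j).2).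

(** Complementing the left input and the right output turns the conservative rule
    back into the complemented one. *)
Definition complemented_vertex_map (u : bool * bool) (bottom left : bool) :
    bool * bool :=
  ((vertex_map u bottom (~~ left)).1, ~~ (vertex_map u bottom (~~ left)).2).

Lemma cs6v_in (w : env) (i j : nat) : (1 <= i)%N -> (1 <= j)%N ->
  cs6v w i j = complemented_vertex_map (w (i, j))
     (bottom_input (cs6v w) i j) (left_input (cs6v w) i j).
Proof.
case: i j => [//|i] [//|j] _ _; rewrite {1}/cs6v /complemented_vertex_map.
have -> : bottom_input (cs6v w) i.+1 j.+1 = (step_flow w i.+1 j).1 by case: j.
have -> : left_input (cs6v w) i.+1 j.+1 = ~~ (step_flow w i j.+1).2.
  by case: i.
by rewrite negbK {1 2}/step_flow flowP.
Qed.

Lemma cs6v_local (w w' : env) (i j : nat) : (1 <= i)%N -> (1 <= j)%N ->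
  (forall i' j', (i' < i)%N -> (j' < j)%N -> w (i'.+1, j'.+1) = w' (i'.+1, j'.+1)) ->
  cs6v w i j = cs6v w' i j.
Proof.
case: i j => [//|i] [//|j] _ _ ww'.
by rewrite /cs6v /step_flow (@flow_local w w').
Qed.

Lemma height_cs6v (w : env) (x y : nat) :
  (height (cs6v w) x y + crossings w x y = y)%N.
Proof.
have := conservation x y (@flowP w xpred0 xpredT).
rewrite -/(step_flow w) step_flow_tops0 -/(crossings w 0 y) crossings0.
rewrite -/(crossings w x y) addn0 /height big_add1 /= big_mkord.
rewrite -/(tops (cs6v w) x y) -[tops (cs6v w) x y]/(tops (step_flow w) x y).
by case: y => [|y] /=; rewrite ?step_flow_tops0; lia.
Qed.

(** * Averaging over independent sites *)

Definition update (w : env) (v : nat * nat) (u : bool * bool) : env :=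
  fun v' => if v' == v then u else w v'.

Definition weights (R : numDomainType) (p : nat * nat -> bool * bool -> R) : Prop :=
  (forall v u, 0 <= p v u) /\ (forall v, \sum_u p v u = 1).

Definition average (R : numDomainType) (p : nat * nat -> bool * bool -> R)
    (v : nat * nat) (F : env -> R) : env -> R :=
  fun w => \sum_u p v u * F (update w v u).

(** Integration against the product measure over a finite set of sites, as
    iterated single-site averages. Averages commute and are idempotent,
    so neither the order nor the multiplicities in the list matter. *)
Definition expect (R : numDomainType) (p : nat * nat -> bool * bool -> R)
    (l : seq (nat * nat)) (F : env -> R) : env -> R := foldr (average p) F l.

Definition depends_on (A : Type) (S : pred (nat * nat)) (F : env -> A) : Prop :=
  forall w w', (forall v, S v -> w v = w' v) -> F w = F w'.

Lemma updateC (w : env) (v v' : nat * nat) (u u' : bool * bool) : v != v' ->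
  update (update w v u) v' u' = update (update w v' u') v u.
Proof.
move=> vv'; apply/funext => z; rewrite /update.
by case: eqP => // ->; rewrite eq_sym (negbTE vv').
Qed.

Lemma averageC (R : numDomainType) (p : nat * nat -> bool * bool -> R)
    (v v' : nat * nat) (F : env -> R) :
  average p v (average p v' F) = average p v' (average p v F).
Proof.
have [-> //|vv'] := eqVneq v v'.
apply/funext => w; rewrite /average.
under eq_bigr do rewrite mulr_sumr.
rewrite exchange_big /=; apply: eq_bigr => u _; rewrite mulr_sumr.
by apply: eq_bigr => u' _; rewrite mulrCA updateC.
Qed.

Lemma expectC (R : numDomainType) (p : nat * nat -> bool * bool -> R)
    (l l' : seq (nat * nat)) (F : env -> R) :
  expect p l (expect p l' F) = expect p l' (expect p l F).
Proof.
elim: l => //= v l ->; elim: l' => //= v' l' IH.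
by rewrite averageC IH.
Qed.

Lemma expectD (R : numDomainType) (p : nat * nat -> bool * bool -> R)
    (l : seq (nat * nat)) (F G : env -> R) (w : env) :
  expect p l (fun w => F w + G w) w = expect p l F w + expect p l G w.
Proof.
elim: l w => //= v l IH w; rewrite /average -big_split /=.
by apply: eq_bigr => u _; rewrite IH mulrDr.
Qed.

Lemma expectZ (R : numDomainType) (p : nat * nat -> bool * bool -> R)
    (l : seq (nat * nat)) (c : R) (F : env -> R) (w : env) :
  expect p l (fun w => c * F w) w = c * expect p l F w.
Proof.
elim: l w => //= v l IH w; rewrite /average mulr_sumr.
by apply: eq_bigr => u _; rewrite IH mulrCA.
Qed.

Lemma expect_cst (R : numDomainType) (p : nat * nat -> bool * bool -> R)
    (l : seq (nat * nat)) (c : R) (w : env) : weights p ->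
  expect p l (fun=> c) w = c.
Proof.
move=> [_ p1]; elim: l w => //= v l IH w; rewrite /average.
by under eq_bigr do rewrite IH; rewrite -mulr_suml p1 mul1r.
Qed.

Lemma le_expect (R : numDomainType) (p : nat * nat -> bool * bool -> R)
    (l : seq (nat * nat)) (F G : env -> R) (w : env) : weights p ->
  (forall w, F w <= G w) -> expect p l F w <= expect p l G w.
Proof.
move=> [p0 _] FG; elim: l w => //= v l IH w.
by apply: ler_sum => u _; rewrite ler_wpM2l.
Qed.

Lemma average_depends_on (R : numDomainType) (p : nat * nat -> bool * bool -> R)
    (v : nat * nat) (S : pred (nat * nat)) (F : env -> R) :
  depends_on S F -> depends_on [predD1 S & v] (average p v F).
Proof.
move=> SF w w' ww'; apply: eq_bigr => u _; congr (_ * _); apply: SF => z Sz.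
by rewrite /update; case: (eqVneq z v) => // zv; apply: ww'; rewrite /= zv.
Qed.

Lemma depends_onW (A : Type) (S S' : pred (nat * nat)) (F : env -> A) :
  (forall v, S v -> S' v) -> depends_on S F -> depends_on S' F.
Proof. by move=> SS' SF w w' ww'; apply: SF => v /SS'; exact: ww'. Qed.

Lemma expect_depends_on (R : numDomainType) (p : nat * nat -> bool * bool -> R)
    (l : seq (nat * nat)) (S : pred (nat * nat)) (F : env -> R) :
  depends_on S F -> depends_on [predD S & [in l]] (expect p l F).
Proof.
move=> SF; elim: l => [|v l IH] /=.
  by apply: depends_onW SF => v Sv; apply/andP; split.
apply: depends_onW (average_depends_on p (v := v) IH) => z /= /and3P[zv zl Sz].
by rewrite !inE negb_or zv zl.
Qed.

(** Each list of averages makes F constant, and the two lists commute; averaging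
    a constant does nothing. So one may average over any finite set of sites that
    covers those that F reads. *)
Lemma expect_covering (R : numDomainType) (p : nat * nat -> bool * bool -> R)
    (l l' : seq (nat * nat)) (S : pred (nat * nat)) (F : env -> R) (w w' : env) :
  weights p -> depends_on S F ->
  {subset S <= l} -> {subset S <= l'} ->
  expect p l F w = expect p l' F w'.
Proof.
move=> pw SF Sl Sl'.
have cst (m : seq (nat * nat)) : {subset S <= m} ->
    expect p m F = fun=> expect p m F w.
  move=> Sm; apply/funext => z; apply: (expect_depends_on p (l := m) SF) => v.
  by move=> /andP[/negP vm Sv]; case: vm; exact: Sm.
have := congr1 (@^~ w) (expectC p l l' F).
rewrite /= (cst l Sl) (cst l' Sl') !expect_cst // => ->.
Qed.

(** Independence: each single-site average acts on at most one of the factors. *)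
Lemma expectM (R : numDomainType) (p : nat * nat -> bool * bool -> R)
    (l : seq (nat * nat)) (S S' : pred (nat * nat)) (F G : env -> R) (w : env) :
  weights p -> depends_on S F -> depends_on S' G ->
  (forall v, S v -> S' v -> False) ->
  expect p l (fun w => F w * G w) w = expect p l F w * expect p l G w.
Proof.
move=> [_ p1] SF SG dis; elim: l w => //= v l IH w; rewrite /average.
have absorb (U : pred (nat * nat)) (K : env -> R) u : depends_on U K -> ~~ U v ->
    expect p l K (update w v u) = expect p l K w.
  move=> UK Uv; apply: (expect_depends_on p (l := l) UK) => z /andP[_ Uz].
  by rewrite /update; case: eqP => // zv; case/negP: Uv; rewrite -zv.
under eq_bigr do rewrite IH.
have [Sv|Sv] := boolP (S v).
- have S'v : ~~ S' v by apply/negP => S'v; exact: dis S'v.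
  under eq_bigr do rewrite (absorb _ _ _ SG S'v) mulrA.
  under [in RHS]eq_bigr do rewrite [_ * _]mulrC.
  under [X in _ = _ * X]eq_bigr do rewrite (absorb _ _ _ SG S'v).
  rewrite -mulr_suml -[X in _ = _ * X]mulr_suml p1 mul1r.
  by congr (_ * _); apply: eq_bigr => u _; rewrite mulrC.
- under eq_bigr do rewrite (absorb _ _ _ SF Sv) mulrCA.
  under [X in _ = X * _]eq_bigr do rewrite (absorb _ _ _ SF Sv).
  by rewrite -mulr_sumr -[X in _ = X * _]mulr_suml p1 mul1r.
Qed.

Lemma expect_shift (R : numDomainType) (p : nat * nat -> bool * bool -> R)
    (l : seq (nat * nat)) (x y : nat) (F : env -> R) (w : env) :
  (forall v, v \in l -> p (x + v.1, y + v.2)%N = p v) ->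
  expect p [seq (x + v.1, y + v.2)%N | v <- l] (fun w => F (shift_env x y w)) w =
  expect p l F (shift_env x y w).
Proof.
elim: l w => //= v l IH w pl; rewrite /average; apply: eq_bigr => u _.
rewrite pl ?mem_head // IH => [|z zl]; last by apply: pl; rewrite inE zl orbT.
congr (_ * expect p l F _); apply/funext => z; rewrite /shift_env /update.
by rewrite !xpair_eqE !eqn_add2l -xpair_eqE -!surjective_pairing.
Qed.

(** * Moments of the number of crossings *)

Definition bernoulli_weight (R : realType) (b : R) (u : bool) : R :=
  if u then b else 1 - b.

(** Reading the parameters at indices that are at least 1 makes this a
    probability law at every site, as parameters with a zero index are arbitrary. *)
Definition site_law (R : realType) (b1 b2 : nat -> nat -> R)
    (v : nat * nat) (u : bool * bool) : R :=
  bernoulli_weight (b1 v.1.-1.+1 v.2.-1.+1) u.1 *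
  bernoulli_weight (b2 v.1.-1.+1 v.2.-1.+1) u.2.

Lemma sum_boolbool (R : nmodType) (f : bool * bool -> R) :
  \sum_u f u =
  f (true, true) + f (true, false) + f (false, true) + f (false, false).
Proof.
rewrite (eq_bigr (fun u => f (u.1, u.2))) => [|[] //].
by rewrite -(pair_bigA _ (fun a b => f (a, b))) /= !big_bool /= !addrA.
Qed.

Lemma site_law_weights (R : realType) (b1 b2 : nat -> nat -> R) :
  (forall i j : nat, (1 <= i)%N -> (1 <= j)%N -> 0 <= b1 i j <= 1) ->
  (forall i j : nat, (1 <= i)%N -> (1 <= j)%N -> 0 <= b2 i j <= 1) ->
  weights (site_law b1 b2).
Proof.
move=> hb1 hb2; split => [v u|v].
- have /andP[h1 h2] := hb1 v.1.-1.+1 v.2.-1.+1 isT isT.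
  have /andP[h3 h4] := hb2 v.1.-1.+1 v.2.-1.+1 isT isT.
  by rewrite mulr_ge0 // /bernoulli_weight; case: ifP; rewrite ?subr_ge0.
- by rewrite sum_boolbool /site_law /bernoulli_weight /=; ring.
Qed.

Definition box (x y : nat) : seq (nat * nat) :=
  [seq (i.+1, j.+1) | i <- iota 0 x, j <- iota 0 y].

Lemma mem_box (x y : nat) (v : nat * nat) :
  (v \in box x y) = [&& 0 < v.1, v.1 <= x, 0 < v.2 & v.2 <= y]%N.
Proof.
apply/allpairsP/and4P => [[[i j] /= []]|[]].
  by rewrite !mem_iota => /andP[_ ix] /andP[_ jy] ->.
case: v => -[//|i] [|j] //= _ ix _ jy.
by exists (i, j); rewrite !mem_iota.
Qed.

Lemma crossings_depends_on (x y : nat) :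
  depends_on [in box x y] (fun w => crossings w x y).
Proof.
move=> w w' ww'; apply: crossings_local => i j ix jy; apply: ww'.
by rewrite /= mem_box /= ix jy.
Qed.

Lemma shifted_crossings_depends_on (x y x' y' : nat) :
  depends_on [pred v : nat * nat | (x < v.1)%N && (y < v.2)%N]
    (fun w => crossings (shift_env x y w) x' y').
Proof.
move=> w w' ww'; apply: crossings_local => i j ix jy; apply: ww'.
by rewrite /=; lia.
Qed.

Lemma depends_on_comp (A B : Type) (S : pred (nat * nat)) (F : env -> A)
    (f : A -> B) : depends_on S F -> depends_on S (fun w => f (F w)).
Proof. by move=> SF w w' /SF ->. Qed.

Definition default_env : env := fun=> (true, true).

Definition crossings_moment (R : realType) (p : nat * nat -> bool * bool -> R)
    (f : R -> R) (x y : nat) : R :=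
  expect p (box x y) (fun w => f (crossings w x y)%:R) default_env.

Notation mean p := (crossings_moment p id).
Notation square p := (crossings_moment p (fun a => a ^+ 2)).

Lemma crossings_momentE (R : realType) (p : nat * nat -> bool * bool -> R)
    (f : R -> R) (x y : nat) (l : seq (nat * nat)) (w : env) :
  weights p -> {subset box x y <= l} ->
  crossings_moment p f x y = expect p l (fun w => f (crossings w x y)%:R) w.
Proof.
move=> pw xyl; apply: (expect_covering _ _ pw _ _ xyl) => //.
exact: (depends_on_comp (fun n => f n%:R) (@crossings_depends_on x y)).
Qed.

Definition periodic (A : Type) (p : nat * nat -> A) (x y : nat) : Prop :=
  forall v, (0 < v.1)%N -> (0 < v.2)%N -> p (x + v.1, y + v.2)%N = p v.

(** Periodicity of the law makes the dynamics restarted at a period a copy in law of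
    the original one. *)
Lemma shifted_crossings_moment (R : realType)
    (p : nat * nat -> bool * bool -> R) (f : R -> R) (x y x' y' : nat)
    (l : seq (nat * nat)) (w : env) :
  weights p -> periodic p x y -> {subset box (x + x') (y + y') <= l} ->
  expect p l (fun w => f (crossings (shift_env x y w) x' y')%:R) w =
  crossings_moment p f x' y'.
Proof.
move=> pw pxy xyl.
pose s := [seq (x + v.1, y + v.2)%N | v <- box x' y'].
rewrite (@expect_covering _ _ l s [in s] _ _ w) //.
- rewrite (@expect_shift _ _ _ _ _ (fun w => f (crossings w x' y')%:R))
    => [|v]; last first.
    by rewrite mem_box => /and4P[v1 _ v2 _]; exact: pxy.
  by rewrite -crossings_momentE.
- move=> z z' zz'; congr (f _%:R).
  apply: (@crossings_depends_on x' y') => v vxy.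
  by apply: zz'; apply/mapP; exists v.
- move=> _ /mapP[v vxy ->]; apply: xyl; move: vxy; rewrite !mem_box /=; lia.
Qed.

Lemma mean_subadditive (R : realType) (p : nat * nat -> bool * bool -> R)
    (x x' y y' : nat) : weights p -> periodic p x y ->
  mean p (x + x') (y + y') <= mean p x y + mean p x' y'.
Proof.
move=> pw pxy; pose l := box (x + x') (y + y').
have xyl : {subset box x y <= l} by move=> v; rewrite !mem_box; lia.
rewrite (crossings_momentE id default_env pw xyl).
rewrite -(@shifted_crossings_moment _ p id x y x' y' l default_env pw pxy) //.
rewrite -expectD; apply: le_expect => // w.
by rewrite -natrD ler_nat crossings_subadditive.
Qed.

Definition variance (R : realType) (p : nat * nat -> bool * bool -> R)
    (x y : nat) : R := square p x y - mean p x y ^+ 2.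

(** Expand the square of the sum of two independent copies of the crossings, which
    bounds the crossings of the doubled rectangle: the cross terms only contribute
    the square of the mean. The deficit compared with four times the second moment
    is twice the variance. *)
Lemma square_double (R : realType) (p : nat * nat -> bool * bool -> R)
    (x y : nat) : weights p -> periodic p x y ->
  square p (x + x) (y + y) <= 4 * square p x y - 2 * variance p x y.
Proof.
move=> pw pxy; pose l := box (x + x) (y + y).
have xyl : {subset box x y <= l} by move=> v; rewrite !mem_box; lia.
(* [c] and [c'] read disjoint blocks of sites, hence are independent, and have
   the same law. *)
pose c := fun w : env => (crossings w x y)%:R : R.
pose c' := fun w : env => (crossings (shift_env x y w) x y)%:R : R.
have -> : 4 * square p x y - 2 * variance p x y =
    expect p l (fun w => (c w ^+ 2 + c' w ^+ 2) + 2 * (c w * c' w)) default_env.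
  rewrite expectD expectD expectZ.
  rewrite (@expectM _ _ _ [in box x y]
    [pred v : nat * nat | (x < v.1)%N && (y < v.2)%N] c c') //.
  - have Ec : expect p l c default_env = mean p x y.
      by rewrite (crossings_momentE id default_env pw xyl).
    have Ec' : expect p l c' default_env = mean p x y.
      exact: (shifted_crossings_moment id default_env pw pxy).
    have Ecc : expect p l (fun w => c w ^+ 2) default_env = square p x y.
      by rewrite (crossings_momentE (fun a => a ^+ 2) default_env pw xyl).
    have Ecc' : expect p l (fun w => c' w ^+ 2) default_env = square p x y.
      exact: (shifted_crossings_moment (fun a => a ^+ 2) default_env pw pxy).
    by rewrite Ec Ec' Ecc Ecc' /variance; ring.
  - exact: (depends_on_comp (fun n => n%:R) (@crossings_depends_on x y)).
  - exact: (depends_on_comp (fun n => n%:R) (@shifted_crossings_depends_on x y x y)).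
  - by move=> v /=; rewrite mem_box; lia.
apply: le_expect => // w.
have -> : c w ^+ 2 + c' w ^+ 2 + 2 * (c w * c' w) = (c w + c' w) ^+ 2 by ring.
by rewrite lerXn2r ?nnegrE ?addr_ge0 // -natrD ler_nat crossings_subadditive.
Qed.

Lemma chebyshev (R : realType) (p : nat * nat -> bool * bool -> R)
    (x y : nat) (l : seq (nat * nat)) (t : R) (w : env) :
  weights p -> {subset box x y <= l} -> 0 < t ->
  expect p l (fun w => (t <= `|(crossings w x y)%:R - mean p x y|)%R%:R) w
    <= variance p x y / t ^+ 2.
Proof.
move=> pw xyl t0; set m := mean p x y.
have -> : variance p x y / t ^+ 2 =
    expect p l (fun w => (t ^+ 2)^-1 * ((crossings w x y)%:R ^+ 2 +
      ((- 2 * m) * (crossings w x y)%:R + m ^+ 2))) w.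
  rewrite expectZ expectD expectD expectZ expect_cst //.
  have Ec := esym (crossings_momentE id w pw xyl).
  have Ecc := esym (crossings_momentE (fun a => a ^+ 2) w pw xyl).
  by rewrite /= in Ec Ecc; rewrite Ec Ecc -/m /variance -/m; ring.
apply: le_expect => // z.
have -> : (crossings z x y)%:R ^+ 2 + (- 2 * m * (crossings z x y)%:R + m ^+ 2) =
    `|(crossings z x y)%:R - m| ^+ 2 by rewrite real_normK ?num_real //; ring.
have [tle|_] := boolP (t <= _).
  by rewrite mulrC ler_pdivlMr ?exprn_gt0 // mul1r lerXn2r ?nnegrE // ltW.
by rewrite mulr_ge0 ?invr_ge0 ?exprn_ge0 // ltW.
Qed.

(** The normalized second moments decrease along doublings, and the variance is
    bounded by twice the decrement, so the sum telescopes. *)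
Lemma variance_dyadic (R : realType) (p : nat * nat -> bool * bool -> R)
    (x y n : nat) : weights p -> (forall k, periodic p (2 ^ k * x) (2 ^ k * y)) ->
  \sum_(k < n) variance p (2 ^ k * x) (2 ^ k * y) / 4 ^+ k <= 2 * square p x y.
Proof.
move=> pw pp.
(* Divided by 4 ^ (k+1), [square_double] bounds half of the k-th term by the
   drop of the normalized second moment from step k to step k + 1. *)
suff H : \sum_(k < n) variance p (2 ^ k * x) (2 ^ k * y) / 4 ^+ k
    <= 2 * (square p x y - square p (2 ^ n * x) (2 ^ n * y) / 4 ^+ n).
  apply: le_trans H _; rewrite ler_pM2l // gerBl divr_ge0 ?exprn_ge0 //.
  rewrite -[leLHS](expect_cst (box (2 ^ n * x) (2 ^ n * y)) _ default_env pw).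
  by apply: le_expect => // w; rewrite sqr_ge0.
elim: n => [|n IHn]; first by rewrite big_ord0 !expn0 !mul1n divr1 subrr mulr0.
rewrite big_ord_recr /=.
have := square_double pw (pp n).
rewrite !addnn -!muln2 !(mulnC (_ * _)%N 2%N) !mulnA -!expnS.
set V := variance _ _ _; set S' := square p (2 ^ n.+1 * x) _.
set S := square p (2 ^ n * x) _ => h.
apply: le_trans (lerD IHn (lexx _)) _.
rewrite -subr_ge0 exprS invfM -/S.
rewrite [X in 0 <= X](_ : _ = (2^-1 * (4 ^+ n)^-1) * (4 * S - 2 * V - S')); last first.
  have : (4 : R) ^+ n != 0 by rewrite expf_neq0.
  by move: ((4 : R) ^+ n) => q q0; field.
by rewrite mulr_ge0 ?subr_ge0 // mulr_ge0 ?invr_ge0 ?exprn_ge0.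
Qed.

Definition lipschitz2 (R : realType) (h : nat -> nat -> R) : Prop :=
  forall x y x' y', `|h x y - h x' y'| <= `|x%:R - x'%:R| + `|y%:R - y'%:R|.

Lemma lipschitz_nat (R : realType) (f : nat -> R) :
  (forall x, `|f x.+1 - f x| <= 1) ->
  forall x x', `|f x - f x'| <= `|x%:R - x'%:R|.
Proof.
move=> f1; suff H x n : `|f (x + n)%N - f x| <= n%:R.
  move=> x x'; have [le|/ltnW le] := leqP x' x.
    by rewrite -(subnKC le) natrD addrAC subrr add0r normr_nat.
  by rewrite -(subnKC le) distrC natrD opprD addNKr normrN normr_nat.
elim: n => [|n IHn]; first by rewrite addn0 subrr normr0.
rewrite addnS -(subrKA (f (x + n)%N)) (le_trans (ler_normD _ _)) //.
by rewrite -natr1 addrC lerD.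
Qed.

Lemma lipschitz2P (R : realType) (h : nat -> nat -> R) :
  (forall x y, `|h x.+1 y - h x y| <= 1) ->
  (forall x y, `|h x y.+1 - h x y| <= 1) -> lipschitz2 h.
Proof.
move=> hx hy x y x' y'.
rewrite -(subrKA (h x' y)) (le_trans (ler_normD _ _)) // lerD //.
  exact: (lipschitz_nat (hx^~ y)).
exact: (lipschitz_nat (hy x')).
Qed.

(** The pathwise Lipschitz bound is preserved by averaging over a common box. *)
Lemma mean_lipschitz (R : realType) (p : nat * nat -> bool * bool -> R) :
  weights p -> lipschitz2 (mean p).
Proof.
move=> pw.
have H x y x' y' : (forall w, (crossings w x' y' <= crossings w x y + 1)%N) ->
    mean p x' y' - mean p x y <= 1.
  move=> h; rewrite lerBlDl; pose l := box (x + x') (y + y').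
  rewrite (@crossings_momentE _ p id x y l default_env) => [|//|v]; last first.
    by rewrite !mem_box; lia.
  rewrite (@crossings_momentE _ p id x' y' l default_env) => [|//|v]; last first.
    by rewrite !mem_box; lia.
  rewrite -[X in _ <= _ + X](expect_cst l _ default_env pw) -expectD.
  by apply: le_expect => // w; rewrite natr1 ler_nat -addn1.
by apply: lipschitz2P => x y; rewrite ler_norml lerNl opprB !H // => w;
  have := crossingsS w x y; have := crossingsSx w x y; lia.
Qed.

(** * The law of the sampled configuration *)

(** The successor of a vertex in the sampling order: up an antidiagonal, then to the
    bottom of the next one. *)
Definition next_vertex (v : nat * nat) : nat * nat :=
  if (v.1 <= 1)%N then (v.2.+1, 1%N) else (v.1.-1, v.2.+1).

Definition positive (v : nat * nat) : bool := (0 < v.1)%N && (0 < v.2)%N.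

Lemma next_vertex_positive (v : nat * nat) : positive v -> positive (next_vertex v).
Proof. by rewrite /positive /next_vertex; case: ifP => /=; lia. Qed.

Lemma sampled_before_next (v : nat * nat) (i j : nat) :
  positive v -> (1 <= i)%N -> (1 <= j)%N ->
  sampled_before i j (next_vertex v).1 (next_vertex v).2 =
  sampled_before i j v.1 v.2 || ((i, j) == v).
Proof.
case: v => a b; rewrite /positive /next_vertex /sampled_before xpair_eqE /=.
by move=> ab i0 j0; case: ifP => /= a1; lia.
Qed.

Lemma enumeration_onto (v : nat * nat) : positive v ->
  exists k, iter k next_vertex (1, 1)%N = v.
Proof.
suff H n j i : (i + j < n)%N -> positive (i, j) ->
    exists k, iter k next_vertex (1, 1)%N = (i, j).
  by case: v => i j; apply: H; exact: ltnSn.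
elim: n j i => // n IHn j; elim: j => [|j IHj] i.
  by rewrite /positive /= andbF.
rewrite /positive /=.
case: j IHj => [_|j IHj] ijn i0.
- case: i ijn i0 => [//|[|i]] ijn _; first by exists 0%N.
  have [|//|k kE] := IHn i.+1 1%N; first by lia.
  by exists k.+1; rewrite iterS kE.
- have [|//|k kE] := IHj i.+1; first by lia.
  by exists k.+1; rewrite iterS kE /next_vertex /=; case: i {ijn kE} i0.
Qed.

Lemma enumeration_covers (x y : nat) : exists n, forall v : nat * nat,
  v \in box x y -> sampled_before v.1 v.2
    (iter n next_vertex (1, 1)%N).1 (iter n next_vertex (1, 1)%N).2.
Proof.
have [n nE] := @enumeration_onto ((x + y).+1, 1%N) isT.
by exists n => v; rewrite mem_box nE /sampled_before /=; lia.
Qed.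

Definition set_vertex (c : config) (v : nat * nat) (out : bool * bool) : config :=
  fun i j => if (i, j) == v then out else c i j.

Definition agree_before (v : nat * nat) (c c' : config) : Prop :=
  forall i j, (1 <= i)%N -> (1 <= j)%N -> sampled_before i j v.1 v.2 ->
    c i j = c' i j.

Definition sample_vertex (c : config) (v : nat * nat) (u : bool * bool) : config :=
  set_vertex c v (complemented_vertex_map u (bottom_input c v.1 v.2)
                                            (left_input c v.1 v.2)).

(** The probability of the event Q when the vertices of the list are sampled one
    after the other, starting from the partial configuration c. *)
Fixpoint cs6v_prob (R : realType) (p : nat * nat -> bool * bool -> R)
    (l : seq (nat * nat)) (Q : config -> bool) (c : config) : R :=
  if l is v :: l' then \sum_u p v u * cs6v_prob p l' Q (sample_vertex c v u)
  else (Q c)%:R.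

(** Two independent bits reproduce the sampling rule, since a vertex consults at most
    one of them. *)
Lemma vertex_weight_average (R : realType) (b1 b2 : nat -> nat -> R)
    (v : nat * nat) (bottom left : bool) (h : bool * bool -> R) : positive v ->
  \sum_out vertex_weight (b1 v.1 v.2) (b2 v.1 v.2) bottom left out * h out =
  \sum_u site_law b1 b2 v u * h (complemented_vertex_map u bottom left).
Proof.
case: v => -[|i] [|j] // _; rewrite !sum_boolbool /site_law /bernoulli_weight /=.
by rewrite /complemented_vertex_map; case: bottom; case: left => /=; ring.
Qed.

Section sampled_law.
Context (R : realType) (b1 b2 : nat -> nat -> R) (d : measure_display)
  (T : measurableType d) (P : probability T R) (X : T -> config)
  (PX : is_CS6V b1 b2 P X).

Lemma measurable_vertex (i j : nat) (out : bool * bool) :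
  (1 <= i)%N -> (1 <= j)%N -> measurable [set w | X w i j = out].
Proof.
move=> i1 j1; rewrite -[X in measurable X]setTI.
apply: (CS6V_measurable PX i1 j1 measurableT (Y := [set out])).
case: out => a b; rewrite (_ : [set _] = [set a] `*` [set b]).
  exact: measurableX.
by apply/seteqP; split => -[a' b'] /= [-> ->].
Qed.

Lemma measurable_past (v : nat * nat) (c : config) :
  measurable (past_event X v.1 v.2 c).
Proof.
rewrite (_ : past_event _ _ _ _ = \bigcap_i \bigcap_j
   [set w | (1 <= i)%N -> (1 <= j)%N -> sampled_before i j v.1 v.2 ->
     X w i j = c i j]); last first.
  by apply/seteqP; split => w H i => [_ j _|j]; apply: H.
apply: bigcapT_measurable => i; apply: bigcapT_measurable => j.
case: (boolP [&& 1 <= i, 1 <= j & sampled_before i j v.1 v.2]%N).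
  move=> /and3P[i1 j1 ij]; rewrite (_ : mkset _ = [set w | X w i j = c i j]).
    exact: measurable_vertex.
  by apply/seteqP; split => w //= H; apply: H.
move=> /and3P H; rewrite (_ : mkset _ = setT) //.
by apply/seteqP; split => w //= _ i1 j1 ij; case: H.
Qed.

Lemma past_next (v : nat * nat) (c : config) (out : bool * bool) : positive v ->
  past_event X (next_vertex v).1 (next_vertex v).2 (set_vertex c v out) =
  past_event X v.1 v.2 c `&` [set w | X w v.1 v.2 = out].
Proof.
move=> pv; have /andP[v1 v2] := pv; apply/seteqP; split => w /=.
- move=> H; split.
    move=> i j i1 j1 ij; rewrite H // ?sampled_before_next // ?ij //.
    rewrite /set_vertex; case: eqP => // E; move: ij.
    by rewrite -E /sampled_before /= !ltnn andbF.
  by rewrite H // ?sampled_before_next // /set_vertex -surjective_pairing eqxx // orbT.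
- move=> [H Xv] i j i1 j1; rewrite sampled_before_next // /set_vertex.
  have [E _|_] := eqVneq (i, j) v; first by rewrite -Xv -E.
  by rewrite orbF => /(H _ _ i1 j1).
Qed.

(** Additivity over the possible outputs of one vertex; measurability is a
    conclusion as it is established together with the value. *)
Lemma measure_split (A : set T) (i j : nat) : (1 <= i)%N -> (1 <= j)%N ->
  (forall out, measurable (A `&` [set w | X w i j = out])) ->
  measurable A /\ P A = (\sum_out P (A `&` [set w | X w i j = out]))%E.
Proof.
move=> i1 j1 mA; pose r := index_enum (bool * bool)%type.
have -> : A = \bigcup_(out in [set` r]) (A `&` [set w | X w i j = out]).
  apply/seteqP; split => w; last by move=> [out _ []].
  by move=> Aw; exists (X w i j) => //=; rewrite mem_index_enum.
split; first by apply: fin_bigcup_measurable.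
rewrite measure_fin_bigcup //; last first.
  by move=> o o' _ _ [w [[_ Xo] [_ Xo']]]; rewrite -Xo -Xo'.
rewrite -fsbig_seq ?index_enum_uniq //=; apply: eq_bigr => out _; congr (P _).
apply/seteqP; split => w /=; last first.
  by move=> [[a _ [Aw Xa]] Xout]; split.
by move=> [Aw Xo]; split => //; exists out => //=; rewrite mem_index_enum.
Qed.

(** Induction on the number n of vertices still to be sampled before Q is decided:
    splitting over the next output, the sampling rule produces one factor and the
    extended past one more vertex. *)
Lemma past_law (v : nat * nat) (n : nat) (Q : config -> bool) (c : config) :
  positive v ->
  (forall c c', agree_before (iter n next_vertex v) c c' -> Q c = Q c') ->
  measurable (past_event X v.1 v.2 c `&` [set w | Q (X w)]) /\
  P (past_event X v.1 v.2 c `&` [set w | Q (X w)]) =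
  (P (past_event X v.1 v.2 c) *
   (cs6v_prob (site_law b1 b2) (traject next_vertex v n) Q c)%:E)%E.
Proof.
elim: n v c => [|n IHn] v c pv Qdep /=.
- have past := measurable_past v c.
  have QE w : past_event X v.1 v.2 c w -> Q (X w) = Q c.
    by move=> H; apply: Qdep => i j i1 j1; exact: H.
  have [Qc|Qc] := boolP (Q c).
    rewrite (_ : _ `&` _ = past_event X v.1 v.2 c) ?mule1 //.
    by apply/seteqP; split => w //= H; [case: H|split => //; rewrite QE].
  rewrite (_ : _ `&` _ = set0) ?measure0 ?mule0 //.
  by apply/seteqP; split => w //= [H]; rewrite QE // (negbTE Qc).
- have /andP[v1 v2] := pv.
  have Q'dep c1 c2 : agree_before (iter n next_vertex (next_vertex v)) c1 c2 ->
      Q c1 = Q c2 by rewrite -iterSr; exact: Qdep.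
  have step out := IHn _ (set_vertex c v out) (next_vertex_positive pv) Q'dep.
  have E out : past_event X v.1 v.2 c `&` [set w | Q (X w)]
        `&` [set w | X w v.1 v.2 = out] =
      past_event X (next_vertex v).1 (next_vertex v).2 (set_vertex c v out)
        `&` [set w | Q (X w)] by rewrite past_next // setIAC.
  have [|mA ->] := measure_split v1 v2
    (A := past_event X v.1 v.2 c `&` [set w | Q (X w)]).
    by move=> out; rewrite E; case: (step out).
  split => //.
  have fP : P (past_event X v.1 v.2 c) \is a fin_num.
    by apply: fin_num_measure; exact: measurable_past.
  rewrite -(fineK fP) -EFinM /sample_vertex.
  rewrite -(@vertex_weight_average _ _ _ _ _ _
    (fun out => cs6v_prob _ _ Q (set_vertex c v out))) //.
  rewrite mulr_sumr -sumEFin; apply: eq_bigr => out _.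
  rewrite E; have [_ ->] := step out.
  by rewrite past_next // (CS6V_sampling PX) // -(fineK fP) -!EFinM mulrA.
Qed.

End sampled_law.

(** Sampling one more vertex corresponds to refreshing the environment at that
    site: nothing sampled before reads it. *)
Lemma sample_vertex_cs6v (v : nat * nat) (c : config) (w : env) (u : bool * bool) :
  positive v -> agree_before v c (cs6v w) ->
  agree_before (next_vertex v) (sample_vertex c v u) (cs6v (update w v u)).
Proof.
move=> pv cw.
have before i j : (1 <= i)%N -> (1 <= j)%N -> sampled_before i j v.1 v.2 ->
    c i j = cs6v (update w v u) i j.
  move=> i1 j1 ij; rewrite cw //; apply: cs6v_local => // i' j' i'i j'j.
  rewrite /update; case: eqP => // E; move: ij.
  by rewrite -E /sampled_before /=; lia.
move=> i j i1 j1; rewrite sampled_before_next // /sample_vertex /set_vertex.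
have [E _|_] := eqVneq (i, j) v; last by rewrite orbF; exact: before.
rewrite cs6v_in // /update E eqxx; subst v; congr complemented_vertex_map.
- rewrite /bottom_input; case: ifP => // j2.
  by rewrite before //= ?/sampled_before; move: j2 => /=; lia.
- rewrite /left_input; case: ifP => // i2.
  by rewrite before //= ?/sampled_before; move: i2 => /=; lia.
Qed.

(** Sequential sampling and sampling from a fresh environment give
    events the same probability. *)
Lemma cs6v_prob_expect (R : realType) (p : nat * nat -> bool * bool -> R)
    (v : nat * nat) (n : nat) (Q : config -> bool) (c : config) (w : env) :
  positive v ->
  (forall c c', agree_before (iter n next_vertex v) c c' -> Q c = Q c') ->
  agree_before v c (cs6v w) ->
  cs6v_prob p (traject next_vertex v n) Q c =
  expect p (traject next_vertex v n) (fun w => (Q (cs6v w))%:R) w.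
Proof.
elim: n v c w => [|n IHn] v c w pv Qdep cw /=; first by rewrite (Qdep _ _ cw).
apply: eq_bigr => u _; congr (_ * _); apply: IHn.
- exact: next_vertex_positive.
- by rewrite -iterSr.
- exact: sample_vertex_cs6v.
Qed.

Lemma mem_traject_next (v : nat * nat) (n : nat) (i j : nat) :
  positive v -> (1 <= i)%N -> (1 <= j)%N ->
  sampled_before i j (iter n next_vertex v).1 (iter n next_vertex v).2 ->
  sampled_before i j v.1 v.2 || ((i, j) \in traject next_vertex v n).
Proof.
elim: n v => [|n IHn] v pv i1 j1 /=; first by move=> ->.
rewrite -iterS iterSr => /(IHn _ (next_vertex_positive pv) i1 j1).
by rewrite sampled_before_next // inE orbA.
Qed.

(** All events decided in a finite box have the probability prescribed by the
    parameters, whatever the probability space: this is the only place where the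
    abstract process meets the environment. *)
Lemma local_event_law (R : realType) (b1 b2 : nat -> nat -> R)
    (d : measure_display) (T : measurableType d) (P : probability T R)
    (X : T -> config) (x y : nat) (Q : config -> bool) :
  is_CS6V b1 b2 P X ->
  (forall c c', (forall v : nat * nat, v \in box x y -> c v.1 v.2 = c' v.1 v.2) ->
     Q c = Q c') ->
  exists2 l : seq (nat * nat), {subset box x y <= l} &
  measurable [set w | Q (X w)] /\
  P [set w | Q (X w)] =
    (expect (site_law b1 b2) l (fun w => (Q (cs6v w))%:R) default_env)%:E.
Proof.
move=> PX Qloc; have [n boxn] := enumeration_covers x y.
have pos (v : nat * nat) : v \in box x y -> (1 <= v.1)%N && (1 <= v.2)%N 
    by rewrite mem_box => /and4P[-> _ -> _].
have Qdep c c' : agree_before (iter n next_vertex (1, 1)%N) c c' -> Q c = Q c'.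
  move=> cc'; apply: Qloc => v vxy; have /andP[v1 v2] := pos v vxy.
  by apply: cc' => //; exact: boxn.
have first : agree_before (1, 1)%N (cs6v default_env) (cs6v default_env) by [].
exists (traject next_vertex (1, 1)%N n) => [v vxy|].
  have /andP[v1 v2] := pos v vxy.
  have := @mem_traject_next (1, 1)%N n v.1 v.2 isT v1 v2 (boxn v vxy).
  by rewrite -surjective_pairing => /orP[|//]; rewrite /sampled_before /=; lia.
have := past_law PX (v := (1, 1)%N) (cs6v default_env) isT Qdep.
rewrite (cs6v_prob_expect _ _ Qdep first) //.
rewrite (_ : past_event _ _ _ _ = setT); last first.
  by apply/seteqP; split => w // _ i j i1 j1; rewrite /sampled_before /=; lia.
by rewrite setTI probability_setT mul1e.
Qed.

Lemma height_local (c c' : config) (x y : nat) :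
  (forall v : nat * nat, v \in box x y -> c v.1 v.2 = c' v.1 v.2) ->
  height c x y = height c' x y.
Proof.
move=> cc'; rewrite /height; case: eqP => // /eqP y0.
apply: eq_big_nat => i /andP[i0 ix].
by rewrite (cc' (i, y)) // mem_box /=; lia.
Qed.

(** * Almost sure statements *)

Definition config_crossings (R : realType) (c : config) (x y : nat) : R :=
  y%:R - (height c x y)%:R.

Lemma config_crossings_cs6v (R : realType) (w : env) (x y : nat) :
  config_crossings R (cs6v w) x y = (crossings w x y)%:R.
Proof.
by rewrite /config_crossings -{1}(height_cs6v w x y) natrD addrAC subrr add0r.
Qed.

Lemma heightSx (c : config) (x y : nat) :
  (height c x y <= height c x.+1 y <= (height c x y).+1)%N.
Proof.
rewrite /height; case: eqP => // _.
by rewrite (big_nat_recr x.+1) //=; case: (c x.+1 y).1; lia.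
Qed.

(** An arbitrary sample path obeys the vertex rule only almost surely, and without
    the rule the height may jump in the vertical direction. *)
Lemma config_crossings_lipschitz (R : realType) (b1 b2 : nat -> nat -> R)
    (d : measure_display) (T : measurableType d) (P : probability T R)
    (X : T -> config) : weights (site_law b1 b2) -> is_CS6V b1 b2 P X ->
  {ae P, forall w, lipschitz2 (config_crossings R (X w))}.
Proof.
move=> pw PX.
pose Q x y (c : config) :=
  ~~ (height c x y <= height c x y.+1 <= (height c x y).+1)%N.
have Q0 x y : {ae P, forall w, ~~ Q x y (X w)}.
  have Qloc c c' : (forall v : nat * nat, v \in box x y.+1 -> c v.1 v.2 = c' v.1 v.2) ->
      Q x y c = Q x y c'.
    move=> cc'; rewrite /Q (height_local cc') (@height_local c c' x y) // => v.
    by move=> vxy; apply: cc'; move: vxy; rewrite !mem_box; lia.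
  have [l _ [mQ PQ]] := local_event_law PX Qloc.
  exists [set w | Q x y (X w)]; split => //; last by move=> w /= /negP; rewrite negbK.
  rewrite PQ (_ : (fun w => _) = fun=> 0) ?expect_cst //.
  apply/funext => w; rewrite /Q.
  have step : (height (cs6v w) x y <= height (cs6v w) x y.+1 <=
      (height (cs6v w) x y).+1)%N.
    have := height_cs6v w x y; have := height_cs6v w x y.+1.
    by have := crossingsS w x y; lia.
  by rewrite step.
have : {ae P, forall w, forall x y, ~~ Q x y (X w)}.
  by apply: ae_foralln => x; apply: ae_foralln => y; exact: Q0.
apply: filterS => w Qw; apply: lipschitz2P => x y.
- have := heightSx (X w) x y; rewrite /config_crossings.
  rewrite -!(ler_nat R) -natr1 => /andP[h1 h2].
  by rewrite ler_norml; apply/andP; split; lra.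
- have := Qw x y; rewrite negbK /config_crossings.
  rewrite -!(ler_nat R) -!natr1 => /andP[h1 h2].
  by rewrite ler_norml; apply/andP; split; lra.
Qed.

Lemma deviation_bound (R : realType) (b1 b2 : nat -> nat -> R)
    (d : measure_display) (T : measurableType d) (P : probability T R)
    (X : T -> config) (x y : nat) (t : R) :
  weights (site_law b1 b2) -> is_CS6V b1 b2 P X -> 0 < t ->
  let p := site_law b1 b2 in
  let E := [set w | t <= `|config_crossings R (X w) x y - mean p x y|] in
  measurable E /\ (P E <= (variance p x y / t ^+ 2)%:E)%E.
Proof.
move=> pw PX t0 p E.
have Qloc c c' : (forall v : nat * nat, v \in box x y -> c v.1 v.2 = c' v.1 v.2) ->
    (t <= `|config_crossings R c x y - mean p x y|) =
    (t <= `|config_crossings R c' x y - mean p x y|).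
  by move=> cc'; rewrite /config_crossings (height_local cc').
have [l xyl [mE PE]] := local_event_law PX Qloc; split => //.
rewrite PE lee_fin; apply: le_trans (chebyshev default_env pw xyl t0).
by apply: le_expect => // w; rewrite config_crossings_cs6v.
Qed.

(** Borel-Cantelli, with the summable variances of [variance_dyadic]. Deviations
    below 2 ^ k suffice: precision is gained later by letting the direction (x, y)
    grow. *)
Lemma dyadic_deviation (R : realType) (b1 b2 : nat -> nat -> R)
    (d : measure_display) (T : measurableType d) (P : probability T R)
    (X : T -> config) (x y : nat) :
  weights (site_law b1 b2) -> is_CS6V b1 b2 P X ->
  (forall k, periodic (site_law b1 b2) (2 ^ k * x) (2 ^ k * y)) ->
  {ae P, forall w, exists K : nat, forall k : nat, (K <= k)%N ->
    `|config_crossings R (X w) (2 ^ k * x) (2 ^ k * y)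
      - mean (site_law b1 b2) (2 ^ k * x) (2 ^ k * y)| < 2 ^+ k}.
Proof.
move=> pw PX pper; set p := site_law b1 b2.
have t0 k : 0 < 2 ^+ k :> R by rewrite exprn_gt0.
pose F k := [set w | 2 ^+ k <= `|config_crossings R (X w) (2 ^ k * x) (2 ^ k * y)
      - mean p (2 ^ k * x) (2 ^ k * y)|].
have mF k : measurable (F k).
  by case: (deviation_bound (2 ^ k * x) (2 ^ k * y) pw PX (t0 k)).
exists (lim_sup_set F); split.
- by apply: bigcapT_measurable => n; apply: bigcup_measurable => k _.
- apply: lim_sup_set_cvg0 => //.
  apply: (@le_lt_trans _ _ (2 * square p x y)%:E); last exact: ltry.
  apply: lime_le; first by apply: is_cvg_nneseries => n _ _; exact: measure_ge0.
  apply: nearW => n; rewrite big_mkord.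
  apply: (@le_trans _ _ (\sum_(k < n)
      (variance p (2 ^ k * x) (2 ^ k * y) / 4 ^+ k)%:E)%E).
    apply: lee_sum => k _.
    have [_] := deviation_bound (2 ^ k * x) (2 ^ k * y) pw PX (t0 k).
    by rewrite exprAC (_ : 2 ^+ 2 = 4 :> R) //; ring.
  by rewrite sumEFin lee_fin; exact: variance_dyadic.
- move=> w /= nK n _; apply: contrapT => H; apply: nK; exists n => k nk.
  by rewrite ltNge; apply/negP => tk; apply: H; exists k.
Qed.

(** * Interpolation and the subadditive limit *)

Lemma cvg_nat_epsilon (R : realType) (u : nat -> R) (l : R) :
  (forall e, 0 < e -> exists N, forall n, (N <= n)%N -> `|u n - l| <= e) ->
  u @ \oo --> l.
Proof.
move=> H; apply/cvgrPdist_le => e /H[N HN]; exists N => // n Nn.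
by rewrite distrC; exact: HN.
Qed.

Lemma archimedean (R : realType) (a e : R) : 0 < e ->
  exists N : nat, forall n, (N <= n)%N -> a <= e * n%:R.
Proof.
move=> e0; exists (Num.truncn (a / e)).+1 => n Nn.
rewrite mulrC -ler_pdivrMr // (le_trans (ltW (truncnS_gt _))) //.
by rewrite ler_nat.
Qed.

Lemma bounded_over_n (R : realType) (u : nat -> R) (C : R) :
  (forall n, `|u n| <= C) -> (fun n => u n / n%:R) @ \oo --> (0 : R).
Proof.
move=> uC; apply: cvg_nat_epsilon => e e0; have [N HN] := archimedean C e0.
exists N.+1 => n Nn; have n0 : (0 : R) < n%:R by rewrite ltr0n; lia.
rewrite subr0 normrM normfV (ger0_norm (ltW n0)) ler_pdivrMr //.
by rewrite (le_trans (uC n)) // HN //; lia.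
Qed.

(** Euclidean division of n by an index that nearly achieves the infimum. *)
Lemma fekete (R : realType) (u : nat -> R) :
  (forall n, 0 <= u n) -> (forall m n, u (m + n)%N <= u m + u n) ->
  cvgn (fun n => u n / n%:R).
Proof.
move=> u0 usub; pose E : set R := [set u n.+1 / n.+1%:R | n in [set: nat]].
have lbE : has_lbound E.
  by exists 0 => _ [n _ <-]; rewrite divr_ge0.
have infE : has_inf E by split => //; exists (u 1%N / 1%:R); exists 0%N.
apply/cvg_ex; exists (inf E); apply: cvg_nat_epsilon => e e0.
have e2 : 0 < e / 2 by rewrite divr_gt0.
have [_ [m _ <-] um] := inf_adherent e2 infE.
pose M := \sum_(r < m.+1) u r.
have [N HN] := archimedean M e2.
exists N.+1 => n Nn; have n0 : (0 : R) < n%:R by rewrite ltr0n; lia.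
have lower : inf E <= u n / n%:R.
  by apply: ge_inf => //; exists n.-1 => //; rewrite prednK //; lia.
have inf0 : 0 <= inf E.
  by apply: lb_le_inf => [|_ [k _ <-]]; [case: infE|rewrite divr_ge0].
have euclid q r : u (q * m.+1 + r)%N <= q%:R * u m.+1 + u r.
  elim: q => [|q IHq]; first by rewrite mul0n add0n mul0r add0r.
  rewrite mulSn -addnA (le_trans (usub _ _)) // -natr1 mulrDl mul1r.
  by rewrite addrAC [leRHS]addrC lerD2l.
have rM : u (n %% m.+1)%N <= M.
  rewrite /M (bigD1 (Ordinal (ltn_pmod n (ltn0Sn m)))) //=.
  by rewrite lerDl sumr_ge0.
have qn : (n %/ m.+1)%:R * m.+1%:R <= n%:R :> R by rewrite -natrM ler_nat leq_divM.
have upper : u n / n%:R <= inf E + e.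
  rewrite ler_pdivrMr // {1}(divn_eq n m.+1) (le_trans (euclid _ _)) //.
  apply: (@le_trans _ _ ((inf E + e / 2) * n%:R + e / 2 * n%:R)); last first.
    by rewrite -mulrDl -addrA -splitr.
  apply: lerD; last by rewrite (le_trans rM) // HN //; lia.
  apply: le_trans (_ : (inf E + e / 2) * ((n %/ m.+1)%:R * m.+1%:R) <= _); last first.
    by rewrite ler_wpM2l // addr_ge0 // ltW.
  rewrite mulrCA ler_wpM2l // -ler_pdivrMr ?ltr0n //; exact: ltW.
by rewrite ger0_norm ?subr_ge0 // lerBlDl.
Qed.

Lemma truncn_near (R : realType) (x : R) : 0 <= x ->
  `|(Num.truncn x)%:R - x| <= 1.
Proof.
move=> /truncn_itv /andP[h1 h2]; rewrite -natr1 in h2.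
by rewrite ler_norml; apply/andP; split; lra.
Qed.

(** n exceeds the multiple of 2 ^ k below it by less than 2 ^ k, which accounts for
    2 ^ k * x; the two truncations account for 2 ^ k * I and 1. *)
Lemma dyadic_rounding (R : realType) (x : R) (I n k : nat) :
  0 <= x -> (0 < I)%N ->
  `|(Num.truncn (n%:R * x))%:R
    - (2 ^ k * (Num.truncn ((n %/ 2 ^ k)%:R * x / I%:R) * I))%:R|
    <= 2 ^+ k * (x + I%:R + 1).
Proof.
move=> x0 I0; set a := Num.truncn (n%:R * x); set q := (n %/ 2 ^ k)%N.
set b := Num.truncn _.
have I0' : 0 < I%:R :> R by rewrite ltr0n.
have /andP[a1 a2] : a%:R <= n%:R * x < a.+1%:R by rewrite truncn_itv ?mulr_ge0.
have /andP[b1 b2] : b%:R <= q%:R * x / I%:R < b.+1%:R.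
  by rewrite truncn_itv // divr_ge0 // mulr_ge0.
rewrite ler_pdivlMr // in b1; rewrite ltr_pdivrMr // in b2.
have t1 : 1 <= 2 ^+ k :> R by rewrite exprn_ege1 // ler1n.
have t0 : 0 < 2 ^+ k :> R by rewrite exprn_gt0.
have n1 : q%:R * 2 ^+ k <= n%:R :> R.
  by rewrite -natrX -natrM ler_nat leq_divM.
have n2 : n%:R <= (q%:R + 1) * 2 ^+ k :> R.
  by rewrite natr1 -natrX -natrM ler_nat ltnW // -ltn_divLR ?expn_gt0.
rewrite -natr1 in a2; rewrite -natr1 in b2; rewrite !natrM natrX.
have h1 := ler_wpM2r x0 n1; have h2 := ler_wpM2r x0 n2.
have h3 : 2 ^+ k * (b%:R * I%:R) <= 2 ^+ k * (q%:R * x) by rewrite ler_pM2l.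
have h4 : 2 ^+ k * (q%:R * x) <= 2 ^+ k * ((b%:R + 1) * I%:R).
  by rewrite ler_pM2l // ltW.
have h5 : 0 <= 2 ^+ k * I%:R :> R by rewrite mulr_ge0 // ltW.
have h6 : 0 <= 2 ^+ k * x by rewrite mulr_ge0 // ltW.
by rewrite ler_norml; apply/andP; split; lra.
Qed.

(** For large n, n is close to m * 2 ^ k with m between 2 ^ r and 2 ^ (r+1). The
    error made by the Lipschitz bound and the deviation at the grid point are both
    of order 2 ^ k, that is, of order n / 2 ^ r, and r is arbitrary. *)
Lemma dyadic_interpolation (R : realType) (D : nat -> nat -> R) (I J : nat) :
  (0 < I)%N -> (0 < J)%N ->
  (forall x y x' y', `|D x y - D x' y'| <=
     2 * (`|x%:R - x'%:R| + `|y%:R - y'%:R|)) ->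
  (forall a b, exists K : nat, forall k, (K <= k)%N ->
     `|D (2 ^ k * (a * I))%N (2 ^ k * (b * J))%N| < 2 ^+ k) ->
  forall x y : R, 0 <= x -> 0 <= y ->
  (fun n : nat => D (Num.truncn (n%:R * x)) (Num.truncn (n%:R * y)) / n%:R)
    @ \oo --> (0 : R).
Proof.
move=> I0 J0 Dlip Ddyadic x y x0 y0; apply: cvg_nat_epsilon => e e0.
pose C := 1 + 2 * ((x + I%:R + 1) + (y + J%:R + 1)).
have C0 : 0 <= C by rewrite /C !(addr_ge0, mulr_ge0).
have [r Hr] := archimedean C e0.
have Cr : C <= e * 2 ^+ r.
  by rewrite -natrX; apply: Hr; exact: ltnW (ltn_expl _ _).
pose p (m : nat) := Num.truncn (m%:R * x / I%:R).
pose q (m : nat) := Num.truncn (m%:R * y / J%:R).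
have [K HK] : exists K : nat -> nat, forall m k, (K m <= k)%N ->
    `|D (2 ^ k * (p m * I))%N (2 ^ k * (q m * J))%N| < 2 ^+ k.
  by have [K HK] := choice (fun m => Ddyadic (p m) (q m)); exists K.
pose L := (\max_(m < 2 ^ r.+1) K m)%N.
exists (2 ^ (L + r))%N => n Ln.
have n0 : (0 < n)%N by rewrite (leq_trans _ Ln) ?expn_gt0.
have lt : (L + r <= trunc_log 2 n)%N by apply: trunc_log_max.
(* n is written as m * 2 ^ k up to an error below 2 ^ k, with m of r + 1 binary
   digits: only finitely many directions m occur. *)
pose k := (trunc_log 2 n - r)%N.
have /andP[n1 n2] := trunc_log_bounds (isT : (1 < 2)%N) n0.
have tE : (trunc_log 2 n = k + r)%N by rewrite /k; lia.
rewrite tE in n1 n2; rewrite -addnS !expnD in n1 n2.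
pose m := (n %/ 2 ^ k)%N.
have mr : (m < 2 ^ r.+1)%N by rewrite /m ltn_divLR ?expn_gt0 // mulnC.
have Km : (K m <= k)%N.
  have := leq_bigmax (F := fun m : 'I_(2 ^ r.+1) => K m) (Ordinal mr).
  by rewrite -/L /= /k; lia.
have t0 : 0 < 2 ^+ k :> R by rewrite exprn_gt0.
have Dn : `|D (Num.truncn (n%:R * x)) (Num.truncn (n%:R * y))| <= 2 ^+ k * C.
  rewrite -(subrK (D (2 ^ k * (p m * I)) (2 ^ k * (q m * J)))%N (D _ _)).
  rewrite (le_trans (ler_normD _ _)) // /C mulrDr mulr1 addrC.
  apply: lerD; first exact: ltW (HK m k Km).
  rewrite (le_trans (Dlip _ _ _ _)) // mulrCA ler_pM2l // mulrDr.
  by apply: lerD; exact: dyadic_rounding.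
rewrite subr0 normrM normfV normr_nat ler_pdivrMr ?ltr0n //.
rewrite (le_trans Dn) // (le_trans (y := 2 ^+ k * (e * 2 ^+ r))) ?ler_pM2l //.
by rewrite mulrCA ler_pM2l // -!natrX -natrM ler_nat.
Qed.

Lemma truncn_quasi_additive (R : realType) (z : R) (m n : nat) : 0 <= z ->
  `|(Num.truncn ((m + n)%:R * z))%:R
    - (Num.truncn (m%:R * z) + Num.truncn (n%:R * z))%:R| <= 2%:R :> R.
Proof.
move=> z0.
move: (truncn_itv (mulr_ge0 (ler0n R (m + n)) z0)).
move: (truncn_itv (mulr_ge0 (ler0n R m) z0)) (truncn_itv (mulr_ge0 (ler0n R n) z0)).
rewrite !natrD !mulrDl -!natr1 => /andP[h1 h2] /andP[h3 h4] /andP[h5 h6].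
by rewrite ler_norml; apply/andP; split; lra.
Qed.

(** Restricted to multiples of the periods the means are subadditive; rounding to
    such multiples costs a bounded amount, which disappears after division by n. *)
Lemma mean_cvg (R : realType) (p : nat * nat -> bool * bool -> R) (I J : nat)
    (x y : R) :
  weights p -> (0 < I)%N -> (0 < J)%N ->
  (forall a b, periodic p (a * I) (b * J)) -> 0 <= x -> 0 <= y ->
  cvgn (fun n : nat =>
    mean p (Num.truncn (n%:R * x)) (Num.truncn (n%:R * y)) / n%:R).
Proof.
move=> pw I0 J0 pper x0 y0.
pose a n := (Num.truncn (n%:R * (x / I%:R)) * I)%N.
pose b n := (Num.truncn (n%:R * (y / J%:R)) * J)%N.
(* [C] pays for the rounding of directions, which makes u exactly subadditive. *)
pose C : R := 2 * I%:R + 2 * J%:R.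
pose u n := mean p (a n) (b n) + C.
have C0 : 0 <= C by rewrite /C !(addr_ge0, mulr_ge0).
have mean0 x' y' : 0 <= mean p x' y'.
  rewrite -[leLHS](expect_cst (box x' y') _ default_env pw).
  by apply: le_expect.
have ucvg : cvgn (fun n => u n / n%:R).
  apply: fekete => [n|m n]; first by rewrite addr_ge0.
  have := mean_lipschitz pw (a (m + n)%N) (b (m + n)%N) (a m + a n)%N (b m + b n)%N.
  have step (z : R) (k : nat) : 0 <= z ->
      `|(Num.truncn ((m + n)%:R * z) * k)%:R -
        (Num.truncn (m%:R * z) * k + Num.truncn (n%:R * z) * k)%:R| <= 2 * k%:R :> R.
    move=> z0; rewrite -mulnDl !natrM -mulrBl normrM normr_nat ler_wpM2r //.
    exact: truncn_quasi_additive.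
  have := step _ I (divr_ge0 x0 (ler0n R I)).
  have := step _ J (divr_ge0 y0 (ler0n R J)).
  rewrite -/(a _) -/(a _) -/(a _) -/(b _) -/(b _) -/(b _) => hb ha.
  have := @mean_subadditive _ p (a m) (a n) (b m) (b n) pw (pper _ _).
  rewrite /u /C; set M1 := mean _ _ _; set M2 := mean _ _ _; set M3 := mean _ _ _.
  set M4 := mean _ _ _ => hsub /ler_normlP[_ hlip].
  by lra.
have dcvg := @bounded_over_n R (fun n =>
  mean p (Num.truncn (n%:R * x)) (Num.truncn (n%:R * y)) - u n)
  ((x + I%:R + 1) + (y + J%:R + 1) + C).
apply/cvg_ex; exists (limn (fun n => u n / n%:R)).
rewrite -[X in _ --> X]add0r.
under eq_fun => n do rewrite -[mean _ _ _](subrK (u n)) mulrDl.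
apply: cvgD ucvg; apply: dcvg => n.
rewrite /u opprD addrA (le_trans (ler_normB _ _)) //.
rewrite (ger0_norm C0) lerD2r (le_trans (mean_lipschitz pw _ _ _ _)) //.
have rx := @dyadic_rounding R x I n 0 x0 I0.
have ry := @dyadic_rounding R y J n 0 y0 J0.
rewrite !expn0 !divn1 !mul1n !expr0 !mul1r -!mulrA in rx ry.
exact: lerD.
Qed.

Lemma site_law_periodic (R : realType) (b1 b2 : nat -> nat -> R) (I J : nat) :
  (forall i j : nat, (1 <= i)%N -> (1 <= j)%N ->
     [/\ b1 (i + I)%N j = b1 i j, b1 i (j + J)%N = b1 i j,
         b2 (i + I)%N j = b2 i j & b2 i (j + J)%N = b2 i j]) ->
  forall a b, periodic (site_law b1 b2) (a * I) (b * J).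
Proof.
move=> per a b [[//|i] [//|j]] _ _; apply/funext => u.
rewrite /site_law /= !addnS /= -!addSn.
suff [-> ->] : b1 (a * I + i).+1 (b * J + j).+1 = b1 i.+1 j.+1 /\
   b2 (a * I + i).+1 (b * J + j).+1 = b2 i.+1 j.+1 by [].
elim: a => [|a [IHa1 IHa2]].
  rewrite mul0n add0n; elim: b => [|b [IHb1 IHb2]] //.
  rewrite mulSn (_ : (_ + _).+1 = (b * J + j).+1 + J)%N; last by lia.
  by have [_ -> _ ->] := per i.+1 (b * J + j).+1 isT isT.
rewrite mulSn (_ : (_ + _ * _ + _).+1 = (a * I + i).+1 + I)%N; last by lia.
by have [-> _ -> _] := per (a * I + i).+1 (b * J + j).+1 isT isT.
Qed.

(** * The law of large numbers for the height function *)

Theorem theorem1p5 (R : realType) (b1 b2 : nat -> nat -> R)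
  (hb1 : forall i j : nat, (1 <= i)%N -> (1 <= j)%N -> 0 <= b1 i j <= 1)
  (hb2 : forall i j : nat, (1 <= i)%N -> (1 <= j)%N -> 0 <= b2 i j <= 1)
  (hper : exists I J : nat, (1 <= I)%N /\ (1 <= J)%N /\
     forall i j : nat, (1 <= i)%N -> (1 <= j)%N ->
       [/\ b1 (i + I)%N j = b1 i j, b1 i (j + J)%N = b1 i j,
           b2 (i + I)%N j = b2 i j & b2 i (j + J)%N = b2 i j]) :
  exists g : R * R -> R,
    [lipschitz g z | z in quadrant R] /\
    forall (d : measure_display) (T : measurableType d) (P : probability T R)
      (X : T -> config),
      is_CS6V b1 b2 P X ->
      {ae P, forall w, forall x y : R, 0 <= x -> 0 <= y ->
         (fun n : nat =>
            (height (X w) (Num.truncn (n%:R * x)) (Num.truncn (n%:R * y)))%:R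
              / n%:R) @ \oo --> y - g (x, y)}.
Proof.
have pw := site_law_weights hb1 hb2; move: hper => [I [J [I0 [J0 hIJ]]]].
have pper := site_law_periodic hIJ; set p := site_law b1 b2 in pw pper.
pose rate (z : R * R) (n : nat) : R :=
  mean p (Num.truncn (n%:R * z.1)) (Num.truncn (n%:R * z.2)) / n%:R.
have rate_cvg z : quadrant R z -> rate z @ \oo --> limn (rate z).
  by move=> [z1 z2]; exact: mean_cvg pw I0 J0 pper z1 z2.
exists (fun z => limn (rate z)); split.
- exists 2; split; first exact: num_real.
  move=> M M2 [z z'] [/= qz qz'].
  apply: le_trans (_ : 2 * `|z - z'| <= _); last by rewrite ler_wpM2r // ltW.
  have diff : (fun n => `|rate z n - rate z' n|) @ \oo -->
      `|limn (rate z) - limn (rate z')|.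
    by apply: cvg_norm; apply: cvgB; exact: rate_cvg.
  have bound : (fun n : nat => 2 * `|z - z'| + 4 / n%:R) @ \oo --> 2 * `|z - z'|.
    rewrite -[X in _ --> X]addr0; apply: cvgD; first exact: cvg_cst.
    by apply: (bounded_over_n (C := 4)) => n; rewrite ger0_norm.
  suff : `|limn (rate z) - limn (rate z')| <= 2 * `|z - z'| by [].
  apply: ler_cvg_to diff bound _; exists 1%N => // n /= n1.
  have n0 : (0 : R) < n%:R by rewrite ltr0n.
  rewrite /rate -mulrBl normrM normfV normr_nat ler_pdivrMr // mulrDl divfK ?gt_eqF //.
  apply: le_trans (mean_lipschitz pw _ _ _ _) _.
  have coord (s t : R) : 0 <= s -> 0 <= t -> `|s - t| <= `|z - z'| ->
      `|(Num.truncn (n%:R * s))%:R - (Num.truncn (n%:R * t))%:R|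
        <= `|z - z'| * n%:R + 2.
    move=> s0 t0 st.
    have := truncn_near (mulr_ge0 (ler0n R n) s0).
    have := truncn_near (mulr_ge0 (ler0n R n) t0).
    have : `|n%:R * s - n%:R * t| <= `|z - z'| * n%:R.
      by rewrite -mulrBr normrM normr_nat mulrC ler_pM2r.
    move: (_ * n%:R) => N.
    rewrite !ler_norml => /andP[h1 h2] /andP[h3 h4] /andP[h5 h6].
    by apply/andP; split; lra.
  have [qz1 qz2] := qz; have [qz1' qz2'] := qz'.
  have le1 : `|z.1 - z'.1| <= `|z - z'| by rewrite [leRHS]prod_normE le_max lexx.
  have le2 : `|z.2 - z'.2| <= `|z - z'|.
    by rewrite [leRHS]prod_normE le_max lexx orbT.
  by have := coord _ _ qz1 qz1' le1; have := coord _ _ qz2 qz2' le2; lra.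
- move=> d T P X PX.
  have dyadic : {ae P, forall w, forall a b, exists K : nat, forall k, (K <= k)%N ->
      `|config_crossings R (X w) (2 ^ k * (a * I)) (2 ^ k * (b * J))
        - mean p (2 ^ k * (a * I)) (2 ^ k * (b * J))| < 2 ^+ k}.
    apply: ae_foralln => a; apply: ae_foralln => b.
    by apply: dyadic_deviation => // k; rewrite !mulnA; exact: pper.
  apply: filterS2 (config_crossings_lipschitz pw PX) dyadic => w Xlip Xdyadic x y x0 y0.
  pose D x y := config_crossings R (X w) x y - mean p x y.
  have Dlip x1 y1 x2 y2 : `|D x1 y1 - D x2 y2| <=
      2 * (`|x1%:R - x2%:R| + `|y1%:R - y2%:R|).
    rewrite /D opprD addrACA (le_trans (ler_normD _ _)) // mulr2n mulrDl mul1r.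
    by apply: lerD; [exact: Xlip|rewrite -opprD normrN; exact: mean_lipschitz].
  have Dcvg := dyadic_interpolation I0 J0 Dlip Xdyadic x0 y0.
  have qxy : quadrant R (x, y) by [].
  have ycvg : (fun n : nat => (Num.truncn (n%:R * y))%:R / n%:R) @ \oo --> y.
    have := @bounded_over_n R (fun n => (Num.truncn (n%:R * y))%:R - n%:R * y) 1
      (fun n => truncn_near (mulr_ge0 (ler0n R n) y0)).
    move=> /cvgD /(_ (cvg_cst y)); rewrite add0r; apply: cvg_trans.
    apply: near_eq_cvg; exists 1%N => // n /= n1.
    have n0 : n%:R != 0 :> R by rewrite pnatr_eq0 -lt0n.
    by rewrite !fctE mulrBl mulrAC divff // mul1r subrK.
  rewrite -[limn _]addr0.
  apply: cvg_trans (cvgB ycvg (cvgD (rate_cvg _ qxy) Dcvg)).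
  apply: near_eq_cvg; apply: nearW => n.
  rewrite !fctE /rate /D /config_crossings /= -mulrDl -mulrBl; congr (_ / _).
  by ring.
Qed.
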